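(* Let $M\ge 2$ and $b,m,n\ge 1$ be integers, let $\eta_{OV},\eta_{QK}>0$, and put $\alpha_0=\frac{m}{m+n}$. Let $\mu_{OV},\mu_{QK}:[0,\infty)\to\mathbb{R}$ be differentiable functions with $\mu_{OV}(0)=\mu_{QK}(0)=0$ satisfying $$\dot\mu_{OV}(t)=\frac{\eta_{OV}\,\alpha(t)}{b\big(e^{\alpha(t)\mu_{OV}(t)}+M-1\big)},\qquad \dot\mu_{QK}(t)=\eta_{QK}\,\frac{(M-1)\,\alpha(t)(1-\alpha(t))\,\mu_{OV}(t)}{M b^2\big(e^{\alpha(t)\mu_{OV}(t)}+M-1\big)},$$ where $\alpha(t)=\frac{m e^{\mu_{QK}(t)}}{m e^{\mu_{QK}(t)}+n}$. (1) For all $t\ge 0$, $$\log\!\Big(1+\frac{\eta_{OV}\alpha_0}{Mb}\,t\Big)\le \mu_{OV}(t)\le \frac{1}{\alpha_0}\log\!\Big(1+\frac{\eta_{OV}\alpha_0}{b}\,t\Big).$$ (2) For all $t\ge 0$, $$\mu_{QK}(t)\le \frac{\eta_{QK}}{\eta_{OV}}\,\frac{(M-1)(1-\alpha_0)}{2Mb\,\alpha_0^2}\,\log^2\!\Big(1+\frac{\eta_{OV}\alpha_0}{b}\,t\Big).$$ (3) If $\delta\in(0,1)$ and $T>0$ are such that $\alpha(t)\le 1-\delta$ for all $t\in[0,T]$, then for all $t\in[0,T]$, $$\mu_{QK}(t)\ge \frac{\eta_{QK}}{\eta_{OV}}\,\frac{(M-1)\,\delta}{2Mb}\,\log^2\!\Big(1+\frac{\eta_{OV}\alpha_0}{Mb}\,t\Big).$$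 In particular, if $\alpha(t)\le 1-\delta$ on $[0,T]$ with $\delta\in(0,1)$, then for all $t\in[0,T]$, $$\mu_{OV}(t)=\Theta\big(\ln(1+t)\big),\qquad \mu_{QK}(t)=\Theta\Big(\frac{\eta_{QK}}{\eta_{OV}}\,(\ln(1+t))^2\Big).$$
   Context: $\log=\ln$ is the natural logarithm. Here $f(t)=\Theta(g(t))$ for all $t\in[0,T]$ means that there are constants $0<c\le C$, depending only on $\eta_{OV},M,b,m,n,\delta$ (not on $t$, $T$ or $\eta_{QK}$), with $c\,g(t)\le f(t)\le C\,g(t)$ for all $t\in[0,T]$. *)

(* Defs.v *)
From Stdlib Require Import Reals.
Open Scope R_scope.

Definition alpha0 (m n : nat) : R := INR m / (INR m + INR n).

Definition alpha (m n : nat) (mu_QK : R -> R) (t : R) : R :=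
  INR m * exp (mu_QK t) / (INR m * exp (mu_QK t) + INR n).

(* [D_in f d D x] is differentiability relative to the domain [D], so with
   [D = [0, oo)] the derivative at 0 is one-sided and the values of the
   functions at negative arguments play no role. *)
Record is_flow (M b m n : nat) (eta_OV eta_QK : R) (mu_OV mu_QK : R -> R)
  : Prop := {
  flow_OV0 : mu_OV 0 = 0;
  flow_QK0 : mu_QK 0 = 0;
  flow_OV : forall t : R, 0 <= t ->
    D_in mu_OV
      (fun s => eta_OV * alpha m n mu_QK s
        / (INR b * (exp (alpha m n mu_QK s * mu_OV s) + INR M - 1)))
      (fun s => 0 <= s) t;
  flow_QK : forall t : R, 0 <= t ->
    D_in mu_QK
      (fun s => eta_QK *
        ((INR M - 1) * alpha m n mu_QK s * (1 - alpha m n mu_QK s) * mu_OV s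
         / (INR M * INR b ^ 2
            * (exp (alpha m n mu_QK s * mu_OV s) + INR M - 1))))
      (fun s => 0 <= s) t
}.

(* The constants are arguments, so that a statement using this predicate can
   quantify them before the parameters they must not depend on. *)
Definition theta_on (c C T : R) (f g : R -> R) : Prop :=
  forall t : R, 0 <= t <= T -> c * g t <= f t <= C * g t.

(* Main.v *)
(** Where [u = mu_OV] and [q = mu_QK], both derivatives are nonnegative, so
    [u >= 0], [q >= 0] and [alpha >= alpha0]. Then [exp (alpha0 u)] has
    derivative at most [eta_OV alpha0 / b] and [exp u] has derivative at least
    [eta_OV alpha0 / (M b)], which gives (1). Dividing the two equations,
    [q' = eta_QK / eta_OV * (M - 1) / (M b) * (1 - alpha) * u u'], so [q] is
    compared with multiples of [u ^ 2], and (2), (3) follow from (1). *)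
Require Import Defs.
From Stdlib Require Import Reals Lra.
From Coquelicot Require Import Coquelicot.
Open Scope R_scope.

(** * Calculus on the half-line [[0, oo)] *)

(* Differentiability inside the half-line, with one-sided continuity at 0
   expressed through the constant extension to the left. *)
Definition half_line_derive (f f' : R -> R) : Prop :=
  (forall t, 0 <= t -> continuity_pt (fun s => f (Rmax 0 s)) t) /\
  (forall t, 0 < t -> is_derive f t (f' t)).

(** Truncation [Rmax 0] is 1-Lipschitz and fixes every [t >= 0], so relative continuity at [t]
    passes to the extended function with the same radius. At [t > 0], increments smaller than [t]
    stay in the domain, and the relative derivative becomes a two-sided one. *)
Lemma half_line_derive_of_D_in (f f' : R -> R) :
  (forall t, 0 <= t -> D_in f f' (fun s => 0 <= s) t) ->
  half_line_derive f f'.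
Proof.
intros H; split.
- intros t Ht.
  pose proof (cont_deriv _ _ _ _ (H t Ht)) as Hc.
  intros e He; destruct (Hc e He) as [d [Hd Hb]].
  exists d; split; [exact Hd|].
  intros x [_ Hx]; simpl in *.
  rewrite (Rmax_right 0 t) by lra.
  destruct (Req_dec (Rmax 0 x) t) as [->|Hne].
  + unfold Rdist; rewrite Rminus_diag, Rabs_R0; lra.
  + apply Hb; split.
    * split; [apply Rmax_l | now apply not_eq_sym].
    * apply Rle_lt_trans with (2 := Hx); unfold Rdist, Rmax.
      destruct (Rle_dec 0 x); [lra|].
      unfold Rabs; destruct (Rcase_abs (0 - t)), (Rcase_abs (x - t)); lra.
- intros t Ht; apply is_derive_Reals.
  intros e He; destruct (H t (Rlt_le _ _ Ht) e He) as [d [Hd Hb]].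
  assert (Hm : 0 < Rmin d t) by (apply Rmin_glb_lt; lra).
  exists (mkposreal _ Hm); simpl; intros h Hh0 Hh.
  assert (Hhd : Rabs h < d) by (apply Rlt_le_trans with (1 := Hh), Rmin_l).
  assert (Hht : Rabs h < t) by (apply Rlt_le_trans with (1 := Hh), Rmin_r).
  apply Rabs_def2 in Hht.
  specialize (Hb (t + h)); simpl in Hb; unfold Rdist in Hb.
  replace (t + h - t) with h in Hb by ring.
  apply Hb; split; [|exact Hhd].
  split; lra.
Qed.

Lemma half_line_derive_comp (phi phi' f f' : R -> R) :
  (forall x, is_derive phi x (phi' x)) -> half_line_derive f f' ->
  half_line_derive (fun t => phi (f t)) (fun t => f' t * phi' (f t)).
Proof.
intros Hphi [Hc Hd]; split.
- intros t Ht.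
  apply (continuity_pt_comp (fun s => f (Rmax 0 s)) phi); [now apply Hc|].
  apply derivable_continuous_pt.
  exists (phi' (f (Rmax 0 t))); apply is_derive_Reals, Hphi.
- intros t Ht.
  apply (is_derive_comp phi f); [apply Hphi | now apply Hd].
Qed.

Lemma half_line_derive_id : half_line_derive (fun t => t) (fun _ => 1).
Proof.
split.
- intros t _ e He; exists e; split; [exact He|].
  intros x [_ Hx]; simpl in *; unfold Rdist in *.
  apply Rle_lt_trans with (2 := Hx).
  unfold Rmax; destruct (Rle_dec 0 x), (Rle_dec 0 t); split_Rabs; lra.
- intros t _; apply (is_derive_id (K := R_AbsRing) t).
Qed.

(** The mean value theorem on [[0, t]], applied to [g - f] precomposed with [Rmax 0]: the extension
    supplies the two-sided continuity at 0, and derivatives are only taken at interior points. All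
    later estimates on solutions go through this comparison. *)
Lemma half_line_le (T : R) (f f' g g' : R -> R) :
  half_line_derive f f' -> half_line_derive g g' ->
  (forall t, 0 <= t <= T -> f' t <= g' t) -> f 0 <= g 0 ->
  forall t, 0 <= t <= T -> f t <= g t.
Proof.
intros [Hfc Hfd] [Hgc Hgd] Hle H0 t Ht.
destruct (Req_dec t 0) as [->|Hne]; [exact H0|].
destruct (MVT_gen (fun s => g (Rmax 0 s) - f (Rmax 0 s)) 0 t
            (fun s => g' s - f' s)) as [c [Hc E]];
  rewrite ?Rmin_left, ?(Rmax_right 0 t) in * by lra.
- intros x Hx.
  (* On the ball of radius [x] around [x] the truncation is the identity. *)
  apply (is_derive_ext_loc (fun s => g s - f s)).
  + assert (Hx0 : 0 < x) by lra.
    exists (mkposreal x Hx0); intros y Hy.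
    apply Rabs_def2 in Hy; simpl in Hy; unfold minus, plus, opp in Hy; simpl in Hy.
    now rewrite Rmax_right by lra.
  + apply (is_derive_minus g f); [apply Hgd | apply Hfd]; lra.
- intros x Hx; apply continuity_pt_minus; [apply Hgc | apply Hfc]; lra.
- rewrite Rmax_left in E by lra.
  assert (Hpos : 0 <= (g' c - f' c) * (t - 0)).
  { specialize (Hle c ltac:(lra)); apply Rmult_le_pos; lra. }
  lra.
Qed.

(** The factor [1] is the derivative of the identity, left as the chain rule produces it. *)
Lemma half_line_derive_of_derive (f f' : R -> R) :
  (forall x, is_derive f x (f' x)) -> half_line_derive f (fun t => 1 * f' t).
Proof.
intros H; exact (half_line_derive_comp f f' _ _ H half_line_derive_id).
Qed.

(** * Comparison of logarithms at different time scales *)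

Lemma exp_le (x y : R) : x <= y -> exp x <= exp y.
Proof.
intros [H| ->]; [now apply Rlt_le, exp_increasing | apply Rle_refl].
Qed.

(* Bernoulli's inequality, read through the substitution [t = exp x - 1]. *)
Lemma ln_scale_bounds (k t : R) : 0 < k -> 0 <= t ->
  Rmin 1 k * ln (1 + t) <= ln (1 + k * t) <= Rmax 1 k * ln (1 + t).
Proof.
intros Hk Ht.
pose (f := fun x => exp (k * x)); pose (g := fun x => 1 + k * (exp x - 1)).
assert (Hf : half_line_derive f (fun x => 1 * (k * exp (k * x)))).
{ apply half_line_derive_of_derive; intros x; unfold f; auto_derive; [easy|ring]. }
assert (Hg : half_line_derive g (fun x => 1 * (k * exp x))).
{ apply half_line_derive_of_derive; intros x; unfold g; auto_derive; [easy|ring]. }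
assert (Hfg0 : f 0 = g 0) by (unfold f, g; rewrite Rmult_0_r, exp_0; ring).
assert (Hx0 : 0 <= ln (1 + t)).
{ rewrite <- ln_1; apply ln_le; lra. }
assert (Hgx : g (ln (1 + t)) = 1 + k * t).
{ unfold g; rewrite exp_ln by lra; ring. }
assert (Hkt : 0 <= k * t) by (apply Rmult_le_pos; lra).
set (x := ln (1 + t)) in *.
(* Since [f' = k * exp (k * s)] and [g' = k * exp s], the sign of [k - 1] decides which of
   [exp (k * x)] and [1 + k * t] is larger. The remaining bound in each case, with factor 1, is
   monotonicity of [ln]. *)
destruct (Rle_or_lt k 1) as [Hk1|Hk1].
- rewrite Rmin_right, Rmax_left by lra; split.
  + rewrite <- (ln_exp (k * x)); apply ln_le; [apply exp_pos|].
    rewrite <- Hgx.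
    apply (half_line_le x f _ g _ Hf Hg); [|lra|lra].
    intros s Hs; rewrite !Rmult_1_l.
    apply Rmult_le_compat_l; [lra|]; apply exp_le; nra.
  + rewrite Rmult_1_l; apply ln_le; nra.
- rewrite Rmin_left, Rmax_right by lra; split.
  + rewrite Rmult_1_l; apply ln_le; nra.
  + rewrite <- (ln_exp (k * x)); apply ln_le; [lra|].
    rewrite <- Hgx.
    apply (half_line_le x g _ f _ Hg Hf); [|lra|lra].
    intros s Hs; rewrite !Rmult_1_l.
    apply Rmult_le_compat_l; [lra|]; apply exp_le; nra.
Qed.

(** * Derivatives of the comparison functions *)

Lemma half_line_derive_affine (c k : R) :
  half_line_derive (fun t => c + k * t) (fun _ => 1 * k).
Proof.
apply (half_line_derive_of_derive _ (fun _ => k)).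
intros x; auto_derive; [easy|ring].
Qed.

Lemma half_line_derive_exp (k : R) (f f' : R -> R) :
  half_line_derive f f' ->
  half_line_derive (fun t => exp (k * f t))
    (fun t => f' t * (k * exp (k * f t))).
Proof.
apply (half_line_derive_comp (fun x => exp (k * x)) (fun x => k * exp (k * x))).
intros x; auto_derive; [easy|ring].
Qed.

Lemma half_line_derive_sqr (k : R) (f f' : R -> R) :
  half_line_derive f f' ->
  half_line_derive (fun t => k / 2 * f t ^ 2) (fun t => f' t * (k * f t)).
Proof.
apply (half_line_derive_comp (fun x => k / 2 * x ^ 2) (fun x => k * x)).
intros x; auto_derive; [easy|field].
Qed.

(** * Comparison estimates for the coupled system *)

(** The weight [a] is abstract: it enters only through its range and through the lower bound [a0],
    available once [q] is known to be nonnegative. Signs are therefore settled in the order [u],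
    [q], [a]. The estimates of [q] stay in terms of [u ^ 2]; logarithms are substituted
    afterwards. *)
Lemma coupled_flow_bounds (M b eta kappa a0 : R) (a u q : R -> R) :
  1 < M -> 0 < b -> 0 < eta -> 0 < kappa -> 0 < a0 ->
  u 0 = 0 -> q 0 = 0 ->
  half_line_derive u (fun t => eta * a t / (b * (exp (a t * u t) + M - 1))) ->
  half_line_derive q (fun t => kappa * ((M - 1) * a t * (1 - a t) * u t
    / (M * b ^ 2 * (exp (a t * u t) + M - 1)))) ->
  (forall t, 0 < a t < 1) ->
  (forall t, 0 <= q t -> a0 <= a t) ->
  (forall t, 0 <= t ->
     0 <= u t /\
     ln (1 + eta * a0 / (M * b) * t) <= u t
       <= 1 / a0 * ln (1 + eta * a0 / b * t)) /\
  (forall t, 0 <= t ->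
     q t <= kappa / eta * ((M - 1) / (M * b)) * (1 - a0) / 2 * u t ^ 2) /\
  (forall delta T, (forall t, 0 <= t <= T -> a t <= 1 - delta) ->
     forall t, 0 <= t <= T ->
     kappa / eta * ((M - 1) / (M * b)) * delta / 2 * u t ^ 2 <= q t).
Proof.
intros HM Hb Heta Hkappa Ha0 Hu0 Hq0.
set (u' := fun t => eta * a t / (b * (exp (a t * u t) + M - 1))).
set (K := kappa / eta * ((M - 1) / (M * b))).
intros Hu Hq' Ha Haq.
assert (HD : forall t, 0 < exp (a t * u t) + M - 1)
  by (intros t; pose proof (exp_pos (a t * u t)); lra).
assert (Hq : half_line_derive q (fun t => K * (1 - a t) * u t * u' t)).
{ destruct Hq' as [Hc Hd]; split; [exact Hc|]; intros t Ht.
  evar_last; [now apply Hd|].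
  unfold K, u'; field; specialize (HD t); lra. }
clear Hq'.
assert (HMb : 0 < M * b) by (apply Rmult_lt_0_compat; lra).
assert (HK : 0 < K).
{ unfold K; apply Rmult_lt_0_compat; apply Rdiv_lt_0_compat; lra. }
assert (Hu'0 : forall t, 0 < u' t).
{ intros t; unfold u'; apply Rdiv_lt_0_compat; apply Rmult_lt_0_compat;
    solve [apply HD | lra | apply Ha]. }
(* The zero function, in the form [0 + 0 * t], is the lower comparison function for both [u] and
   [q]. *)
assert (H0 := half_line_derive_affine 0 0).
assert (Hupos : forall t, 0 <= t -> 0 <= u t).
{ intros t Ht; replace 0 with (0 + 0 * t) by ring.
  apply (half_line_le t _ _ _ _ H0 Hu); [|lra|lra].
  intros s _; specialize (Hu'0 s); lra. }
assert (HKuu : forall t, 0 <= t -> 0 <= K * u' t * u t).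
{ intros t Ht; apply Rmult_le_pos; [|now apply Hupos].
  apply Rlt_le, Rmult_lt_0_compat; [exact HK | apply Hu'0]. }
(* Only [a t < 1] and [u >= 0] are used here, so deducing [a0 <= a t] from the result is not
   circular. *)
assert (Hqpos : forall t, 0 <= t -> 0 <= q t).
{ intros t Ht; replace 0 with (0 + 0 * t) by ring.
  apply (half_line_le t _ _ _ _ H0 Hq); [|lra|lra].
  intros s Hs; rewrite Rmult_0_r.
  replace (K * (1 - a s) * u s * u' s) with (K * u' s * u s * (1 - a s)) by ring.
  apply Rmult_le_pos; [apply HKuu; lra|]; specialize (Ha s); lra. }
assert (Haa : forall t, 0 <= t -> a0 <= a t) by auto.
assert (Hk : 0 < eta * a0) by now apply Rmult_lt_0_compat.
split; [|split].
- intros t Ht; split; [now apply Hupos|split].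
  + rewrite <- (ln_exp (u t)).
    assert (0 <= eta * a0 / (M * b) * t).
    { apply Rmult_le_pos; [|lra]; apply Rlt_le, Rdiv_lt_0_compat; lra. }
    apply ln_le; [lra|].
    rewrite <- (Rmult_1_l (u t)).
    apply (half_line_le t _ _ _ _ (half_line_derive_affine 1 (eta * a0 / (M * b)))
             (half_line_derive_exp 1 _ _ Hu)); [| |lra].
    2: { rewrite Hu0, !Rmult_0_r, exp_0; lra. }
    intros s Hs; unfold u'; rewrite !Rmult_1_l.
    specialize (HD s); specialize (Hupos s ltac:(lra)); specialize (Ha s).
    specialize (Haa s ltac:(lra)).
    (* From [D <= E] and [1 <= E] follows [D + M - 1 <= M * E]; together with [a0 <= a s] this
       bounds the derivative of [exp u] from below. *)
    assert (HE : exp (a s * u s) <= exp (u s)) by (apply exp_le; nra).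
    assert (HE1 : 1 <= exp (u s)) by (rewrite <- exp_0; apply exp_le; lra).
    set (E := exp (u s)) in *; set (D := exp (a s * u s)) in *.
    apply Rmult_le_reg_r with (M * b * (D + M - 1)); [nra|].
    replace (eta * a0 / (M * b) * (M * b * (D + M - 1)))
      with (eta * (a0 * (D + M - 1))) by (field; lra).
    replace (eta * a s / (b * (D + M - 1)) * E * (M * b * (D + M - 1)))
      with (eta * (a s * (M * E))) by (field; lra).
    apply Rmult_le_compat_l; [lra|].
    apply Rmult_le_compat; nra.
  + assert (Hmain : a0 * u t <= ln (1 + eta * a0 / b * t)).
    { rewrite <- (ln_exp (a0 * u t)); apply ln_le; [apply exp_pos|].
      apply (half_line_le t _ _ _ _ (half_line_derive_exp a0 _ _ Hu)
               (half_line_derive_affine 1 (eta * a0 / b))); [| |lra].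
      2: { rewrite Hu0, !Rmult_0_r, exp_0; lra. }
      intros s Hs; unfold u'; rewrite !Rmult_1_l.
      specialize (HD s); specialize (Hupos s ltac:(lra)); specialize (Ha s).
      specialize (Haa s ltac:(lra)).
      (* Here [E <= D <= D + M - 1] and [a s <= 1], so the quotient [a s * E / (D + M - 1)] is at
         most 1. *)
      assert (HE : exp (a0 * u s) <= exp (a s * u s)) by (apply exp_le; nra).
      pose proof (exp_pos (a0 * u s)).
      set (E := exp (a0 * u s)) in *; set (D := exp (a s * u s)) in *.
      apply Rmult_le_reg_r with (b * (D + M - 1)); [nra|].
      replace (eta * a0 / b * (b * (D + M - 1)))
        with (eta * a0 * (1 * (D + M - 1))) by (field; lra).
      replace (eta * a s / (b * (D + M - 1)) * (a0 * E) * (b * (D + M - 1)))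
        with (eta * a0 * (a s * E)) by (field; lra).
      apply Rmult_le_compat_l; [lra|].
      apply Rmult_le_compat; lra. }
    apply Rmult_le_reg_l with a0; [lra|].
    apply Rle_trans with (1 := Hmain), Req_le; field; lra.
- intros t Ht.
  apply (half_line_le t _ _ _ _ Hq (half_line_derive_sqr (K * (1 - a0)) _ _ Hu));
    [| |lra].
  2: { rewrite Hq0, Hu0; lra. }
  intros s Hs.
  (* With the nonnegative factor [K * u' * u] isolated, what remains is [1 - a s <= 1 - a0]. *)
  replace (u' s * (K * (1 - a0) * u s)) with (K * u' s * u s * (1 - a0)) by ring.
  replace (K * (1 - a s) * u s * u' s) with (K * u' s * u s * (1 - a s)) by ring.
  apply Rmult_le_compat_l; [apply HKuu; lra|].
  specialize (Haa s ltac:(lra)); lra.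
- intros delta T HT t Ht.
  apply (half_line_le T _ _ _ _ (half_line_derive_sqr (K * delta) _ _ Hu) Hq);
    [| |lra].
  2: { rewrite Hq0, Hu0; lra. }
  intros s Hs.
  replace (u' s * (K * delta * u s)) with (K * u' s * u s * delta) by ring.
  replace (K * (1 - a s) * u s * u' s) with (K * u' s * u s * (1 - a s)) by ring.
  apply Rmult_le_compat_l; [apply HKuu; lra|].
  specialize (HT s Hs); lra.
Qed.

(** * The concrete weight [alpha] and the bounds for the flow *)

Lemma alpha_bounds (m n : nat) (q : R -> R) (t : R) :
  (1 <= m)%nat -> (1 <= n)%nat -> 0 < alpha m n q t < 1.
Proof.
intros Hm%lt_0_INR Hn%lt_0_INR; unfold alpha.
assert (0 < INR m * exp (q t)) by (apply Rmult_lt_0_compat; [lra|apply exp_pos]).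
split; [apply Rdiv_lt_0_compat; lra|].
apply Rlt_div_l; lra.
Qed.

(** After clearing denominators the inequality reduces to [m * n <= m * n * exp (q t)]. *)
Lemma alpha0_le_alpha (m n : nat) (q : R -> R) (t : R) :
  (1 <= m)%nat -> (1 <= n)%nat -> 0 <= q t -> alpha0 m n <= alpha m n q t.
Proof.
intros Hm%lt_0_INR Hn%lt_0_INR Hq; unfold alpha, alpha0.
assert (HE : 1 <= exp (q t)) by (rewrite <- exp_0; now apply exp_le).
assert (0 < INR m * exp (q t)) by (apply Rmult_lt_0_compat; lra).
apply Rle_div_l; [lra|].
replace (INR m * exp (q t) / (INR m * exp (q t) + INR n) * (INR m + INR n))
  with (INR m * exp (q t) * (INR m + INR n) / (INR m * exp (q t) + INR n))
  by (field; lra).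
assert (Hmn : 0 < INR m * INR n) by (apply Rmult_lt_0_compat; lra).
apply Rle_div_r; nra.
Qed.

(** Nonnegativity of [mu_OV] is kept among the conclusions because squaring its logarithmic upper
    bound requires it. *)
Lemma flow_bounds (M b m n : nat) (eta_OV eta_QK : R) (mu_OV mu_QK : R -> R) :
  (2 <= M)%nat -> (1 <= b)%nat -> (1 <= m)%nat -> (1 <= n)%nat ->
  0 < eta_OV -> 0 < eta_QK ->
  is_flow M b m n eta_OV eta_QK mu_OV mu_QK ->
  let A := alpha0 m n in
  let K := eta_QK / eta_OV * ((INR M - 1) / (INR M * INR b)) in
  (forall t, 0 <= t ->
     0 <= mu_OV t /\
     ln (1 + eta_OV * A / (INR M * INR b) * t) <= mu_OV t
       <= 1 / A * ln (1 + eta_OV * A / INR b * t)) /\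
  (forall t, 0 <= t -> mu_QK t <= K * (1 - A) / 2 * mu_OV t ^ 2) /\
  (forall delta T, (forall t, 0 <= t <= T -> alpha m n mu_QK t <= 1 - delta) ->
     forall t, 0 <= t <= T -> K * delta / 2 * mu_OV t ^ 2 <= mu_QK t).
Proof.
intros HM%le_INR Hb%lt_0_INR Hm Hn HOV HQK [Hu0 Hq0 Hu Hq] A K.
assert (HA : 0 < A).
{ unfold A, alpha0; apply lt_0_INR in Hm, Hn; apply Rdiv_lt_0_compat; lra. }
simpl in HM.
apply (coupled_flow_bounds (INR M) (INR b) eta_OV eta_QK A (alpha m n mu_QK));
  try assumption; try lra.
- now apply half_line_derive_of_D_in.
- now apply half_line_derive_of_D_in.
- intros t; now apply alpha_bounds.
- intros t; now apply alpha0_le_alpha.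
Qed.

Theorem lemma3 (M b m n : nat) (eta_OV : R)
  (hM : (2 <= M)%nat) (hb : (1 <= b)%nat) (hm : (1 <= m)%nat)
  (hn : (1 <= n)%nat) (hOV : 0 < eta_OV) :
  (forall (eta_QK : R) (mu_OV mu_QK : R -> R),
     0 < eta_QK ->
     is_flow M b m n eta_OV eta_QK mu_OV mu_QK ->
     (forall t : R, 0 <= t ->
        ln (1 + eta_OV * alpha0 m n / (INR M * INR b) * t) <= mu_OV t
          <= 1 / alpha0 m n * ln (1 + eta_OV * alpha0 m n / INR b * t))
     /\
     (forall t : R, 0 <= t ->
        mu_QK t <=
          eta_QK / eta_OV
          * ((INR M - 1) * (1 - alpha0 m n)
             / (2 * INR M * INR b * alpha0 m n ^ 2))
          * ln (1 + eta_OV * alpha0 m n / INR b * t) ^ 2)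
     /\
     (forall delta T : R, 0 < delta < 1 -> 0 < T ->
        (forall t : R, 0 <= t <= T -> alpha m n mu_QK t <= 1 - delta) ->
        forall t : R, 0 <= t <= T ->
          eta_QK / eta_OV
          * ((INR M - 1) * delta / (2 * INR M * INR b))
          * ln (1 + eta_OV * alpha0 m n / (INR M * INR b) * t) ^ 2
          <= mu_QK t))
  /\
  (forall delta : R, 0 < delta < 1 ->
     exists c1 C1 c2 C2 : R,
       0 < c1 <= C1 /\ 0 < c2 <= C2 /\
       forall (eta_QK T : R) (mu_OV mu_QK : R -> R),
         0 < eta_QK -> 0 < T ->
         is_flow M b m n eta_OV eta_QK mu_OV mu_QK ->
         (forall t : R, 0 <= t <= T -> alpha m n mu_QK t <= 1 - delta) ->
         theta_on c1 C1 T mu_OV (fun t => ln (1 + t)) /\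
         theta_on c2 C2 T mu_QK
           (fun t => eta_QK / eta_OV * ln (1 + t) ^ 2)).

Proof.
set (A := alpha0 m n).
assert (HA : 0 < A < 1).
{ unfold A, alpha0; apply lt_0_INR in hm, hn; split.
  - apply Rdiv_lt_0_compat; lra.
  - apply Rlt_div_l; lra. }
assert (HM : 2 <= INR M) by (apply (le_INR 2) in hM; simpl in hM; lra).
assert (Hb : 0 < INR b) by now apply lt_0_INR.
assert (HMb : 0 < INR M * INR b) by nra.
set (k1 := eta_OV * A / (INR M * INR b)).
set (k2 := eta_OV * A / INR b).
assert (Hk : 0 < eta_OV * A) by (apply Rmult_lt_0_compat; lra).
assert (Hk1 : 0 < k1) by (apply Rdiv_lt_0_compat; lra).
assert (Hk2 : 0 < k2) by (apply Rdiv_lt_0_compat; lra).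
assert (HL : forall k t, 0 < k -> 0 <= t -> 0 <= ln (1 + k * t)).
{ intros k t H H'; rewrite <- ln_1; apply ln_le; nra. }
(* The explicit bounds on [mu_QK] are proved ahead of the split, since the asymptotic statement is
   derived from them as well. *)
assert (Hlow : forall eta_QK mu_OV mu_QK, 0 < eta_QK ->
  is_flow M b m n eta_OV eta_QK mu_OV mu_QK ->
  forall delta T, 0 < delta < 1 ->
  (forall t, 0 <= t <= T -> alpha m n mu_QK t <= 1 - delta) ->
  forall t, 0 <= t <= T ->
  eta_QK / eta_OV * ((INR M - 1) * delta / (2 * INR M * INR b))
    * ln (1 + k1 * t) ^ 2 <= mu_QK t).
{ intros eta_QK mu_OV mu_QK HQK Hflow delta T Hd HT t Ht.
  destruct (flow_bounds _ _ _ _ _ _ _ _ hM hb hm hn hOV HQK Hflow)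
    as [Hu [_ Hq]].
  apply Rle_trans with (2 := Hq delta T HT t Ht).
  replace (eta_QK / eta_OV * ((INR M - 1) * delta / (2 * INR M * INR b)))
    with (eta_QK / eta_OV * ((INR M - 1) / (INR M * INR b)) * delta / 2)
    by (field; lra).
  apply Rmult_le_compat_l.
  - apply Rlt_le; repeat apply Rmult_lt_0_compat; try lra;
      apply Rinv_0_lt_compat; lra.
  - apply pow_incr; split; [apply HL; lra|]; apply Hu; lra. }
assert (Hup : forall eta_QK mu_OV mu_QK, 0 < eta_QK ->
  is_flow M b m n eta_OV eta_QK mu_OV mu_QK ->
  forall t, 0 <= t ->
  mu_QK t <= eta_QK / eta_OV
    * ((INR M - 1) * (1 - A) / (2 * INR M * INR b * A ^ 2))
    * ln (1 + k2 * t) ^ 2).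
{ intros eta_QK mu_OV mu_QK HQK Hflow t Ht.
  destruct (flow_bounds _ _ _ _ _ _ _ _ hM hb hm hn hOV HQK Hflow)
    as [Hu [Hq _]].
  apply Rle_trans with (1 := Hq t Ht); fold A.
  (* The [A ^ 2] in the denominator comes from squaring the factor [1 / A] in the upper bound for
     [mu_OV]. *)
  replace (eta_QK / eta_OV
    * ((INR M - 1) * (1 - A) / (2 * INR M * INR b * A ^ 2))
    * ln (1 + k2 * t) ^ 2)
    with (eta_QK / eta_OV * ((INR M - 1) / (INR M * INR b)) * (1 - A) / 2
          * (1 / A * ln (1 + k2 * t)) ^ 2)
    by (field; lra).
  apply Rmult_le_compat_l.
  - apply Rlt_le; repeat apply Rmult_lt_0_compat; try lra;
      apply Rinv_0_lt_compat; lra.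
  - apply pow_incr; apply Hu in Ht; split; apply Ht. }
split.
- intros eta_QK mu_OV mu_QK HQK Hflow; split; [|split].
  + intros t Ht.
    destruct (flow_bounds _ _ _ _ _ _ _ _ hM hb hm hn hOV HQK Hflow) as [Hu _].
    now apply Hu.
  + exact (Hup _ _ _ HQK Hflow).
  + intros delta T Hd _; now apply (Hlow _ mu_OV).
- intros delta Hd.
  (* [p] and [P] are the coefficients of the explicit bounds once [ln (1 + k1 * t)] and
     [ln (1 + k2 * t)] are traded for multiples of [ln (1 + t)]; neither involves [eta_QK] or
     [T]. *)
  set (p := (INR M - 1) * delta / (2 * INR M * INR b) * Rmin 1 k1 ^ 2).
  set (P := (INR M - 1) * (1 - A) / (2 * INR M * INR b * A ^ 2)
            * Rmax 1 k2 ^ 2).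
  assert (Hmin : 0 < Rmin 1 k1 <= 1)
    by (split; [apply Rmin_glb_lt; lra | apply Rmin_l]).
  assert (Hmax : 1 <= Rmax 1 k2) by apply Rmax_l.
  assert (HA1 : 1 <= 1 / A) by (apply Rle_div_r; lra).
  (* The first pair is ordered because [Rmin 1 k1 <= 1 <= 1 / A * Rmax 1 k2]. For the second, the
     constants precede any flow, so [delta <= 1 - A] is not at hand to give an order between [p] and
     [P]; the maximum enforces it. *)
  exists (Rmin 1 k1), (1 / A * Rmax 1 k2), p, (Rmax p P).
  split; [nra|split].
  { split; [|apply Rmax_l].
    unfold p; apply Rmult_lt_0_compat; [|apply pow_lt; lra].
    apply Rdiv_lt_0_compat; nra. }
  intros eta_QK T mu_OV mu_QK HQK _ Hflow HT.
  assert (Hr : 0 < eta_QK / eta_OV) by now apply Rdiv_lt_0_compat.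
  split; intros t Ht;
    destruct (ln_scale_bounds k1 t Hk1 ltac:(lra)) as [Hl _];
    destruct (ln_scale_bounds k2 t Hk2 ltac:(lra)) as [_ Hr2];
    assert (HL0 : 0 <= ln (1 + t))
      by (rewrite <- (Rmult_1_l t); apply HL; lra).
  + destruct (flow_bounds _ _ _ _ _ _ _ _ hM hb hm hn hOV HQK Hflow) as [Hu _].
    destruct (Hu t ltac:(lra)) as [_ [Hu1 Hu2]]; fold A k1 k2 in Hu1, Hu2.
    split; [lra|].
    apply Rle_trans with (1 := Hu2); rewrite Rmult_assoc.
    apply Rmult_le_compat_l; lra.
  + split.
    * apply Rle_trans with (2 := Hlow _ _ _ HQK Hflow delta T Hd HT t Ht).
      unfold p.
      replace ((INR M - 1) * delta / (2 * INR M * INR b) * Rmin 1 k1 ^ 2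
               * (eta_QK / eta_OV * ln (1 + t) ^ 2))
        with (eta_QK / eta_OV * ((INR M - 1) * delta / (2 * INR M * INR b))
              * (Rmin 1 k1 * ln (1 + t)) ^ 2) by (field; lra).
      apply Rmult_le_compat_l.
      -- apply Rmult_le_pos; [lra|]; apply Rlt_le, Rdiv_lt_0_compat; nra.
      -- apply pow_incr; split; [apply Rmult_le_pos; lra | exact Hl].
    * apply Rle_trans with (1 := Hup _ _ _ HQK Hflow t ltac:(lra)).
      apply Rle_trans with (P * (eta_QK / eta_OV * ln (1 + t) ^ 2)).
      2: { apply Rmult_le_compat_r; [|apply Rmax_r].
           apply Rmult_le_pos; [lra|apply pow2_ge_0]. }
      unfold P.
      replace ((INR M - 1) * (1 - A) / (2 * INR M * INR b * A ^ 2)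
               * Rmax 1 k2 ^ 2 * (eta_QK / eta_OV * ln (1 + t) ^ 2))
        with (eta_QK / eta_OV
              * ((INR M - 1) * (1 - A) / (2 * INR M * INR b * A ^ 2))
              * (Rmax 1 k2 * ln (1 + t)) ^ 2) by (field; lra).
      apply Rmult_le_compat_l.
      -- assert (0 < A ^ 2) by (apply pow_lt; lra).
         apply Rmult_le_pos; [lra|]; apply Rlt_le, Rdiv_lt_0_compat;
           apply Rmult_lt_0_compat; lra.
      -- apply pow_incr; split; [apply HL; lra | exact Hr2].
Qed.
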